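(* Let $T$ be a tree on $n\ge 3$ vertices. Then $\frac{\lambda_2(T)}{\lambda_n(T)}\le\frac1n$, with equality if and only if $T$ is isomorphic to the star $S_n$.
   Context: For a graph $G$ on $n$ vertices, $L_G=D_G-A_G$ is its Laplacian matrix ($D_G$ the diagonal degree matrix, $A_G$ the adjacency matrix), with eigenvalues $0=\lambda_1(G)\le\cdots\le\lambda_n(G)$. $S_n$ denotes the star on $n$ vertices (one vertex adjacent to all $n-1$ others, no other edges). *)

(* Defs.v *)
From HB Require Import structures.
From mathcomp Require Import all_boot all_order all_algebra.
From mathcomp Require Import polyrcf.

Set Implicit Arguments.
Unset Strict Implicit.
Unset Printing Implicit Defensive.

Import Order.TTheory GRing.Theory Num.Theory.
Local Open Scope ring_scope.

Record sgraph := SGraph {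
  vertex :> finType;
  adj : rel vertex;
  adj_sym : symmetric adj;
  adj_irr : irreflexive adj
}.

Definition connected (G : sgraph) : Prop :=
  (0 < #|G|)%N /\ forall x y : G, connect (@adj G) x y.

(* [ucycle] also accepts [:: x; y] for an edge xy, hence the bound on the
   length. *)
Definition acyclic (G : sgraph) : Prop :=
  forall c : seq G, (2 < size c)%N -> ~ ucycle (@adj G) c.

Definition tree (G : sgraph) : Prop := connected G /\ acyclic G.

Definition isomorphic (G H : sgraph) : Prop :=
  exists2 f : G -> H, bijective f & forall x y, adj (f x) (f y) = adj x y.

(* The star on 'I_n, centred at the vertex of value 0. *)
Definition star_adj (n : nat) : rel 'I_n :=
  fun i j => (i != j) && ((i == 0 :> nat) || (j == 0 :> nat)).

Fact star_adj_sym n : symmetric (@star_adj n).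
Proof. by move=> i j; rewrite /star_adj eq_sym orbC. Qed.

Fact star_adj_irr n : irreflexive (@star_adj n).
Proof. by move=> i; rewrite /star_adj eqxx. Qed.

Definition star (n : nat) : sgraph :=
  SGraph (@star_adj_sym n) (@star_adj_irr n).

Definition degree (G : sgraph) (x : G) : nat := #|[set y | adj x y]|.

Definition adj_mx (R : pzRingType) (G : sgraph) : 'M[R]_#|G| :=
  \matrix_(i, j) (adj (enum_val i) (enum_val j))%:R.

Definition degree_mx (R : pzRingType) (G : sgraph) : 'M[R]_#|G| :=
  diag_mx (\row_i (degree (enum_val i))%:R).

Definition laplacian (R : pzRingType) (G : sgraph) : 'M[R]_#|G| :=
  degree_mx R G - adj_mx R G.

(* The eigenvalues in R of M in nondecreasing order, each repeated according
   to its algebraic multiplicity; [rootsR p] is the increasing list of the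
   distinct roots of p.  When M is symmetric, as a Laplacian is, this list has
   length n and algebraic and geometric multiplicities agree. *)
Definition spectrum (R : rcfType) (n : nat) (M : 'M[R]_n) : seq R :=
  flatten [seq nseq (mup x (char_poly M)) x | x <- rootsR (char_poly M)].

(* k is counted from 1, so that [lap_eigenvalue R G 1] is the smallest
   eigenvalue and [lap_eigenvalue R G #|G|] the largest. *)
Definition lap_eigenvalue (R : rcfType) (G : sgraph) (k : nat) : R :=
  (spectrum (laplacian R G))`_k.-1.

(* Main.v *)
(* Let c be a centroid of T, of degree d, so that no branch of T at c has more
   than n/2 vertices, and let B be a largest branch, of size s.  The Rayleigh
   quotient of the vector equal to d at c, -1 on its neighbours and 0 elsewhere
   gives d + 1 <= lambda_n.  A vector constant on B, zero at c and constant on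
   the m = n - 1 - s other vertices, shifted to be orthogonal to the constants,
   gives n lambda_2 <= d + 1, with equality only if s = 1, that is only if T is a
   star.  For a star, lambda_2 >= 1 and lambda_n <= n. *)

Require Import Defs.
From mathcomp Require Import all_boot all_order all_algebra all_fingroup.
From mathcomp Require Import polyrcf complex zify ring lra.
Set Implicit Arguments.
Unset Strict Implicit.
Unset Printing Implicit Defensive.
Import Order.TTheory GRing.Theory Num.Theory.
Local Open Scope ring_scope.
Local Open Scope sesquilinear_scope.

(** * Extremal characterisation of the eigenvalues *)

Lemma sorted_spectrum (R : rcfType) n (M : 'M[R]_n) :
  sorted <=%R (spectrum M).
Proof.
rewrite /spectrum; have := sorted_roots (- cauchy_bound (char_poly M))
  (cauchy_bound (char_poly M)) (char_poly M).
rewrite -/(rootsR _) (sorted_pairwise lt_trans) (sorted_pairwise le_trans).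
elim: (rootsR _) => //= x s IHs /andP[/allP ltxs /IHs sorted_s].
rewrite pairwise_cat sorted_s andbT; apply/andP; split.
  apply/allrelP => y z /nseqP[-> _] /flattenP[t /mapP[u us ->]] /nseqP[-> _].
  exact/ltW/ltxs.
elim: (mup _ _) => //= k ->; rewrite andbT.
by apply/allP => y /nseqP[-> _].
Qed.

Lemma count_spectrum (R : rcfType) n (M : 'M[R]_n) (x : R) :
  count_mem x (spectrum M) = mup x (char_poly M).
Proof.
have p0 : char_poly M != 0 by rewrite monic_neq0 ?char_poly_monic.
have uniq_roots : uniq (rootsR (char_poly M)).
  exact: (sorted_uniq lt_trans ltxx) (sorted_roots _ _ _).
rewrite /spectrum count_flatten -map_comp sumnE big_map.
rewrite (eq_bigr (fun y => (y == x) * mup y (char_poly M))%N); last first.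
  by move=> y _; rewrite /= count_nseq.
have [xr|xr] := boolP (x \in rootsR (char_poly M)).
  rewrite (bigD1_seq x) //= eqxx mul1n big1 ?addn0 // => y /negPf->.
  by rewrite mul0n.
rewrite mupNroot; last first.
  by have := roots_on_rootsR p0 x; rewrite (negPf xr) in_itv /= => ->.
rewrite big_seq big1 // => y yr; case: eqP => [yx|_]; last by rewrite mul0n.
by rewrite -yx yr in xr.
Qed.

Lemma perm_spectrum (R : rcfType) n (M : 'M[R]_n) (s : seq R) :
  char_poly M = \prod_(x <- s) ('X - x%:P) -> perm_eq (spectrum M) s.
Proof.
by move=> Ms; apply/allP => x _ /=; rewrite count_spectrum Ms mu_prod_XsubC.
Qed.

Lemma char_poly_similar (F : fieldType) n (P A B : 'M[F]_n) :
  P \in unitmx -> A = invmx P *m B *m P -> char_poly A = char_poly B.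
Proof.
move=> Pu ->; rewrite /char_poly /char_poly_mx.
pose Pp := map_mx polyC P; pose Qp := map_mx polyC (invmx P).
have QP : Qp *m Pp = 1%:M by rewrite -map_mxM mulVmx // map_mx1.
have -> : 'X%:M - map_mx polyC (invmx P *m B *m P)
    = Qp *m ('X%:M - map_mx polyC B) *m Pp.
  rewrite !map_mxM mulmxBr mulmxBl; congr (_ - _).
  by rewrite mul_mx_scalar -scalemxAl QP scalemx1.
by rewrite !det_mulmx mulrAC -det_mulmx QP det1 mul1r.
Qed.

(* The columns of [U] are the conjugates of an orthonormal eigenbasis, ordered as
   [spectrum M]. *)
Lemma spectral_forms (R : rcfType) n (M : 'M[R]_n) : M^T = M ->
  size (spectrum M) = n /\
  exists2 U : 'M[R[i]]_n, U \in unitmx & forall v : 'rV[R[i]]_n,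
    (v *m v^t*) 0 0 = \sum_i `|(v *m U) 0 i| ^+ 2 /\
    (v *m map_mx (real_complex R) M *m v^t*) 0 0 =
      \sum_(i < n) (real_complex R (spectrum M)`_i) * `|(v *m U) 0 i| ^+ 2.
Proof.
move=> Msym; set A := map_mx (real_complex R) M.
(* Seen over [R[i]], the symmetric matrix is Hermitian, so a unitary [P] diagonalises it, with real
   diagonal entries. *)
have Asym : A \is hermsymmx.
  apply: realsym_hermsym.
    by rewrite qualifE /= expr0 scale1r map_mx_id // /A map_trmx Msym.
  by apply/mxOverP => i j; rewrite mxE complex_real.
have /orthomx_spectralP AE := hermitian_normalmx Asym.
set P := spectralmx A in AE; set sp := spectral_diag A in AE.
have Pun : P \is unitarymx by exact: spectral_unitarymx.
have Pu : P \in unitmx by exact: unitarymx_unit.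
pose r i : R := complex.Re (sp 0 i).
have spE i : sp 0 i = real_complex R (r i).
  rewrite /r RRe_real //.
  by have /mxOverP -> := hermitian_spectral_diag_real Asym.
pose t := [tuple r i | i < n].
have chM : char_poly M = \prod_(x <- t) ('X - x%:P).
  apply: (map_poly_inj (real_complex R)).
  rewrite map_char_poly -/A (char_poly_similar Pu AE) char_poly_trig; last first.
    exact: diag_mx_is_trig.
  rewrite rmorph_prod /= big_map big_enum /=.
  by apply: eq_bigr => i _; rewrite !mxE eqxx spE mulr1n rmorphB /= map_polyX map_polyC.
have ps := perm_spectrum chM.
have szs : size (spectrum M) = n by rewrite (perm_size ps) size_tuple.
split=> //.
(* The diagonalisation does not sort the eigenvalues; [f] permutes them into the order of
   [spectrum M]. *)
have /tuple_permP[f fE] : perm_eq (Tuple (introT eqP szs)) t by [].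
have sE (i : 'I_n) : (spectrum M)`_i = r (f i).
  have -> : spectrum M = [tuple tnth t (f i) | i < n] := fE.
  by rewrite -tnth_nth !tnth_mktuple.
exists (col_perm f (P^t*)).
  rewrite col_permE unitmx_mul unitmx_perm andbT.
  by rewrite -invmx_unitary // unitmx_inv.
move=> v; have yE i : (v *m col_perm f (P^t*)) 0 i = (v *m P^t*) 0 (f i).
  by rewrite !mxE; apply: eq_bigr => j _; rewrite !mxE.
have vE : v = (v *m P^t*) *m P by rewrite mulmxKtV.
set y := v *m P^t* in vE yE.
have vtE : v^t* = P^t* *m y^t* by rewrite {1}vE trmx_mul map_mxM.
split.
  rewrite vtE mulmxA -/y mxE (reindex_inj (@perm_inj _ f)) /=.
  by apply: eq_bigr => i _; rewrite yE !mxE normCK.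
rewrite vtE AE invmx_unitary // !mulmxA -/y (mulmxtVK _ Pun).
rewrite mxE (reindex_inj (@perm_inj _ f)) /=; apply: eq_bigr => i _.
rewrite yE sE -spE normCK mul_mx_diag [(y ^t*) _ _]mxE !mxE.
by rewrite mulrAC mulrC mulrA.
Qed.

Lemma form_sym (R : comPzRingType) n (M : 'M[R]_n) (x y : 'rV[R]_n) :
  M^T = M -> (x *m M *m y^T) 0 0 = (y *m M *m x^T) 0 0.
Proof.
by move=> Ms; rewrite -[in RHS](trmxK y) -[in RHS]Ms -mulmxA -!trmx_mul [RHS]mxE mulmxA.
Qed.

Lemma map_real_conj (R : rcfType) m n (A : 'M[R]_(m, n)) :
  (map_mx (real_complex R) A)^t* = map_mx (real_complex R) A^T.
Proof. by apply/matrixP => i j; rewrite !mxE; exact: conjc_real. Qed.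

Lemma form_real_complex (R : rcfType) n (M : 'M[R]_n) (x : 'rV[R]_n) :
  (map_mx (real_complex R) x *m map_mx (real_complex R) M
    *m (map_mx (real_complex R) x)^t*) 0 0
  = real_complex R ((x *m M *m x^T) 0 0).
Proof. by rewrite map_real_conj -!map_mxM mxE. Qed.

(** The cross terms of the real and imaginary parts cancel because [M] is symmetric. This brings
    computations in a complex eigenbasis back to real vectors. *)
Lemma form_Re_Im (R : rcfType) n (M : 'M[R]_n) (z : 'rV[R[i]]_n) :
  M^T = M ->
  let p := map_mx (@complex.Re R) z in let q := map_mx (@complex.Im R) z in
  (z *m map_mx (real_complex R) M *m z^t*) 0 0
  = real_complex R ((p *m M *m p^T) 0 0 + (q *m M *m q^T) 0 0).
Proof.
move=> Ms p q; set rc := real_complex R.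
have zE : z = map_mx rc p + 'i%C *: map_mx rc q.
  by apply/matrixP => i j; rewrite !mxE; exact: complexE.
have ztE : z^t* = map_mx rc p^T - 'i%C *: map_mx rc q^T.
  apply/matrixP => i j; rewrite !mxE.
  by case: (z j i) => a b; rewrite /rc; simpc.
rewrite ztE {1}zE !(mulmxDl, mulmxBr) -!(scalemxAl, scalemxAr) -!map_mxM.
have mD (A B : 'M[R[i]]_1) : (A + B) 0 0 = A 0 0 + B 0 0 by rewrite mxE.
have mN (A : 'M[R[i]]_1) : (- A) 0 0 = - A 0 0 by rewrite mxE.
have mZ k (A : 'M[R[i]]_1) : (k *: A) 0 0 = k * A 0 0 by rewrite mxE.
have mr (A : 'M[R]_1) : (map_mx rc A) 0 0 = rc (A 0 0) by rewrite mxE.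
rewrite !(mD, mN, mZ, mr) (form_sym q p Ms) mulrA -expr2 sqr_i mulN1r.
by rewrite opprD opprK addrA addrK /rc rmorphD.
Qed.

Lemma form1_Re_Im (R : rcfType) n (z : 'rV[R[i]]_n) :
  let p := map_mx (@complex.Re R) z in let q := map_mx (@complex.Im R) z in
  (z *m z^t*) 0 0 = real_complex R ((p *m p^T) 0 0 + (q *m q^T) 0 0).
Proof.
by have := form_Re_Im z (trmx1 R n); rewrite map_mx1 mulmx1 /= !mulmx1.
Qed.

Lemma spectrum_nth_le (R : rcfType) n (M : 'M[R]_n) (i j : nat) :
  M^T = M -> (i <= j < n)%N -> (spectrum M)`_i <= (spectrum M)`_j.
Proof.
move=> Ms /andP[ij jn]; have [szs _] := spectral_forms Ms.
apply: (sorted_leq_nth le_trans lexx 0 (sorted_spectrum M)) => //.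
  by rewrite inE szs (leq_ltn_trans ij).
by rewrite inE szs.
Qed.

(** In eigenbasis coordinates the form is a sum of squared moduli weighted by the eigenvalues, each
    at most the last one. *)
Lemma largest_eigen_ge (R : rcfType) n (M : 'M[R]_n) (x : 'rV[R]_n) :
  M^T = M ->
  (x *m M *m x^T) 0 0 <= (spectrum M)`_n.-1 * (x *m x^T) 0 0.
Proof.
move=> Ms; have [_ [U Uu /(_ (map_mx (real_complex R) x))[]]] := spectral_forms Ms.
rewrite form_real_complex map_real_conj -map_mxM mxE => E1 E2.
rewrite -lecR rmorphM /= E1 E2 mulr_sumr ler_sum // => i _.
rewrite ler_wpM2r ?exprn_ge0 // lecR spectrum_nth_le //.
by case: n {M x U Uu E1 E2 Ms} i => [[]//|n] i; rewrite -ltnS ltn_ord /=.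
Qed.

Lemma largest_eigen_le (R : rcfType) n (M : 'M[R]_n) (c : R) :
  (0 < n)%N -> M^T = M ->
  (forall x : 'rV[R]_n, (x *m M *m x^T) 0 0 <= c * (x *m x^T) 0 0) ->
  (spectrum M)`_n.-1 <= c.
Proof.
move=> n_gt0; have n1n : (n.-1 < n)%N by rewrite prednK.
pose k := Ordinal n1n; move=> Ms Mc; have [_ [U Uu UE]] := spectral_forms Ms.
(* A unit eigenvector for the last eigenvalue. It may be complex, so [Mc] is applied to its real and
   imaginary parts, whose squared norms add up to 1. *)
pose z : 'rV[R[i]]_n := delta_mx 0 k *m invmx U.
have zU i : (z *m U) 0 i = (i == k)%:R.
  by rewrite mulmxKV // mxE eqxx.
have [] := UE z; rewrite form_Re_Im //.
rewrite form1_Re_Im => E1 E2.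
have sum1 (f : 'I_n -> R[i]) : \sum_i f i * `|(z *m U) 0 i| ^+ 2 = f k.
  rewrite (bigD1 k) //= zU eqxx normr1 expr1n mulr1 big1 ?addr0 // => i.
  by rewrite zU => /negPf->; rewrite normr0 expr0n mulr0.
have := sum1 (fun=> 1); under eq_bigr do rewrite mul1r.
rewrite -E1 => /(congr1 (@complex.Re R)) /= E1'; move: E2.
rewrite (sum1 (fun i => real_complex R (spectrum M)`_i)) => /complexI <-.
by rewrite -[leRHS]mulr1 -E1' mulrDr lerD ?Mc.
Qed.

(** One half of the Courant-Fischer principle: the span of the first two eigenvectors meets the
    hyperplane orthogonal to [u], and on that span the form is at most the second eigenvalue times
    the squared norm. *)
Lemma second_eigen_ge (R : rcfType) n (M : 'M[R]_n) (u : 'rV[R]_n) (c : R) :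
  (1 < n)%N -> M^T = M ->
  (forall x : 'rV[R]_n, (x *m u^T) 0 0 = 0 ->
     c * (x *m x^T) 0 0 <= (x *m M *m x^T) 0 0) ->
  c <= (spectrum M)`_1.
Proof.
move=> n_gt1 Ms Mc; have [_ [U Uu UE]] := spectral_forms Ms.
pose i0 : 'I_n := Ordinal (ltnW n_gt1); pose i1 : 'I_n := Ordinal n_gt1.
pose ut := map_mx (real_complex R) u^T.
pose g i := ((delta_mx 0 i : 'rV_n) *m invmx U *m ut) 0 0.
(* One linear equation in two unknowns has a nontrivial solution. *)
have [a [b [ab0 gab]]] : exists a b : R[i],
    0 < `|a| ^+ 2 + `|b| ^+ 2 /\ a * g i0 + b * g i1 = 0.
  have [g0|g0] := eqVneq (g i0) 0.
    exists 1, 0; rewrite g0 mulr0 mul0r addr0; split=> //.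
    by rewrite normr1 normr0 expr0n addr0 expr1n.
  exists (g i1), (- g i0); rewrite (mulrC (g i1)) mulNr subrr; split=> //.
  rewrite normrN ltr_wpDl ?exprn_ge0 // exprn_gt0 //.
  by rewrite normr_gt0.
(* A nonzero vector in the span of the first two eigenvectors, orthogonal to u. *)
pose w : 'rV[R[i]]_n := a *: delta_mx 0 i0 + b *: delta_mx 0 i1.
pose z := w *m invmx U.
have zut : (z *m ut) 0 0 = 0.
  by rewrite -[RHS]gab /g /z /w !mulmxDl -!scalemxAl mxE; congr (_ + _); rewrite mxE.
have zU : z *m U = w by rewrite mulmxKV.
have sum2 (f : 'I_n -> R[i]) : \sum_i f i * `|(z *m U) 0 i| ^+ 2
    = f i0 * `|a| ^+ 2 + f i1 * `|b| ^+ 2.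
  rewrite zU (bigD1 i0) //= (bigD1 i1) //= big1 => [|i /andP[/negPf ni0 /negPf ni1]].
    by rewrite !mxE /= !mulr0 !mulr1 addr0 add0r addr0.
  by rewrite !mxE ni0 ni1 /= !mulr0 addr0 normr0 expr0n mulr0.
have [] := UE z; rewrite form_Re_Im // (sum2 (fun i => real_complex R (spectrum M)`_i)).
rewrite form1_Re_Im => E1 E2.
have := sum2 (fun=> 1); under eq_bigr do rewrite mul1r.
rewrite !mul1r -E1 => E1'.
(* Since [u] is real, both parts of [z] are orthogonal to it; [h] stands for the real or the
   imaginary part. *)
have Mp : forall h : R[i] -> R, {morph h : x y / x + y} ->
    (forall k y, h (y * real_complex R k) = h y * k) ->
    (map_mx h z *m u^T) 0 0 = 0.
  move=> h hD hr.
  have h0 : h 0 = 0 by apply: (@addrI _ (h 0)); rewrite -hD !addr0.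
  rewrite -[RHS]h0 -zut !mxE (big_morph h hD h0).
  by apply: eq_bigr => i _; rewrite !mxE hr.
have Rez := Mc _ (Mp _ _ _).
have Imz := Mc _ (Mp _ _ _).
have : real_complex R c * (`|a| ^+ 2 + `|b| ^+ 2)
    <= (real_complex R (spectrum M)`_1) * (`|a| ^+ 2 + `|b| ^+ 2).
  rewrite -E1' -rmorphM /= mulrDr.
  apply: (@le_trans _ _ (real_complex R ((map_mx (@complex.Re R) z *m M *m (map_mx (@complex.Re R) z)^T) 0 0
    + (map_mx (@complex.Im R) z *m M *m (map_mx (@complex.Im R) z)^T) 0 0))).
    rewrite lecR lerD //.
      by apply: Rez => [[? ?] [? ?]|k [? ?]]; simpc.
    by apply: Imz => [[? ?] [? ?]|k [? ?]]; simpc.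
  rewrite E2 E1' mulrDr lerD2r ler_wpM2r ?exprn_ge0 // lecR.
  exact: spectrum_nth_le.
by rewrite ler_pM2r // lecR.
Qed.

(** As [u] lies in the kernel, adding a multiple of it to [x] keeps the form and, by orthogonality,
    can only increase the norm. This freedom serves to cancel the component on the first
    eigenvector, which need not be [u]. *)
Lemma second_eigen_le (R : rcfType) n (M : 'M[R]_n) (u x : 'rV[R]_n) :
  (1 < n)%N -> M^T = M ->
  u != 0 -> u *m M = 0 -> (x *m u^T) 0 0 = 0 -> 0 <= (x *m M *m x^T) 0 0 ->
  (spectrum M)`_1 * (x *m x^T) 0 0 <= (x *m M *m x^T) 0 0.
Proof.
move=> n_gt1 Ms u0 uM xu Mx; set l := (spectrum M)`_1.
have nn_ge0 (y : 'rV[R]_n) : 0 <= (y *m y^T) 0 0.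
  by rewrite mxE sumr_ge0 // => i _; rewrite mxE -expr2 sqr_ge0.
have [l0|l0] := leP l 0.
  by apply: le_trans Mx; rewrite mulr_le0_ge0.
have [_ [U Uu UE]] := spectral_forms Ms.
pose i0 : 'I_n := Ordinal (ltnW n_gt1).
pose rc := map_mx (real_complex R).
(* Without a component on the first eigenvector, only eigenvalues at least [l] carry weight. *)
have key (z : 'rV[R[i]]_n) : (z *m U) 0 i0 = 0 ->
    real_complex R l * (z *m z^t*) 0 0 <= (z *m rc _ _ M *m z^t*) 0 0.
  move=> zU; have [-> ->] := UE z; rewrite mulr_sumr ler_sum // => i _.
  have [->|ii0] := eqVneq i i0; first by rewrite zU normr0 expr0n !mulr0.
  rewrite ler_wpM2r ?exprn_ge0 // lecR spectrum_nth_le // ltn_ord andbT.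
  by rewrite lt0n.
pose b := (rc _ _ u *m U) 0 i0; pose a := (rc _ _ x *m U) 0 i0.
have un0 : 0 < (u *m u^T) 0 0.
  rewrite lt_def nn_ge0 andbT; apply: contra u0 => /eqP; rewrite mxE => /eqP.
  rewrite psumr_eq0 => [/allP u0|i _]; last by rewrite mxE -expr2 sqr_ge0.
  apply/eqP/rowP => i; have := u0 i; rewrite mem_index_enum mxE -expr2 sqrf_eq0 mxE.
  by move/(_ isT)/eqP.
(* If [u] itself has no such component, [l] times its squared norm is at most 0, against [0 < l]. *)
have [b0|b0] := eqVneq b 0.
  have := key _ b0; rewrite form_real_complex map_real_conj -map_mxM.
  rewrite [map_mx _ _ 0 0]mxE -rmorphM /= lecR uM mul0mx [leRHS]mxE.
  by rewrite pmulr_rle0 // leNgt un0.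
(* A vector in the span of u and x, orthogonal to the first eigenvector. *)
pose z := b *: rc _ _ x - a *: rc _ _ u.
have zU : (z *m U) 0 i0 = 0.
  rewrite mulmxBl -!scalemxAl mxE [fun_of_matrix (- _) _ _]mxE.
  by rewrite mxE [fun_of_matrix (a *: _) _ _]mxE -/a -/b (mulrC a) subrr.
have zt : z^t* = b^* *: rc _ _ x^T - a^* *: rc _ _ u^T.
  apply/matrixP => i j; rewrite !mxE rmorphB !rmorphM /=.
  by congr (_ * _ - _ * _); exact: conjc_real.
have := key _ zU.
have Mu : M *m u^T = 0 by rewrite -[M]Ms -trmx_mul uM trmx0.
have ux : u *m x^T = 0.
  by apply/matrixP => i j; rewrite !ord1 -[u *m _]trmxK trmx_mul trmxK mxE xu mxE.
have xu0 : x *m u^T = 0 by apply/matrixP => i j; rewrite !ord1 xu mxE.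
have zM : z *m rc _ _ M = b *: rc _ _ (x *m M).
  by rewrite mulmxBl -!scalemxAl -!map_mxM uM [map_mx _ 0]map_mx0 scaler0 subr0.
have -> : (z *m rc _ _ M *m z^t*) 0 0 = `|b| ^+ 2 * real_complex R ((x *m M *m x^T) 0 0).
  rewrite zM zt mulmxBr -!scalemxAl -!scalemxAr -!map_mxM -[x *m M *m u^T]mulmxA.
  rewrite Mu mulmx0 map_mx0 !scaler0 subr0 scalerA -normCK mxE; congr (_ * _).
  by rewrite mxE.
have -> : (z *m z^t*) 0 0 = `|b| ^+ 2 * real_complex R ((x *m x^T) 0 0)
    + `|a| ^+ 2 * real_complex R ((u *m u^T) 0 0).
  rewrite zt mulmxBl !mulmxBr -!scalemxAl -!scalemxAr -!map_mxM xu0 ux.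
  rewrite !map_mx0 !scaler0 subr0 sub0r opprK !scalerA -!normCK mxE.
  by congr (_ + _); rewrite mxE; congr (_ * _); rewrite mxE.
have b2 : 0 < `|b| ^+ 2 by rewrite exprn_gt0 ?normr_gt0.
move=> le_form; rewrite -lecR -(ler_pM2l b2); apply: le_trans le_form.
rewrite mulrDr rmorphM /= mulrCA lerDl mulr_ge0 ?ler0c ?(ltW l0) //.
by rewrite mulr_ge0 ?exprn_ge0 // ler0c nn_ge0.
Qed.

(** * The Laplacian quadratic form *)

Lemma laplacian_sym (R : pzRingType) (G : sgraph) :
  (laplacian R G)^T = laplacian R G.
Proof.
apply/matrixP => i j; rewrite !mxE adj_sym eq_sym.
by case: eqP => [->|].
Qed.

Definition row_fun (R : Type) (G : sgraph) (f : G -> R) : 'rV[R]_#|G| :=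
  \row_i f (enum_val i).

(* Every edge is counted in both directions. *)
Definition dirichlet (R : pzRingType) (G : sgraph) (f : G -> R) : R :=
  \sum_x \sum_(y | adj x y) (f x - f y) ^+ 2.

Lemma row_funP (R : Type) (G : sgraph) (v : 'rV[R]_#|G|) :
  row_fun (fun x => v 0 (enum_rank x)) = v.
Proof. by apply/rowP => i; rewrite mxE enum_valK. Qed.

Lemma row_fun_mul (R : pzRingType) (G : sgraph) (f g : G -> R) :
  (row_fun f *m (row_fun g)^T) 0 0 = \sum_x f x * g x.
Proof.
rewrite mxE (reindex _ (onW_bij _ (@enum_rank_bij G))) /=.
by apply: eq_bigr => x _; rewrite !mxE enum_rankK.
Qed.

Lemma degree_sum (R : pzRingType) (G : sgraph) (x : G) :
  (degree x)%:R = \sum_(y | adj x y) 1 :> R.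
Proof. by rewrite sumr_const /degree cardsE. Qed.

Lemma row_fun_laplacian (R : comPzRingType) (G : sgraph) (f : G -> R) :
  row_fun f *m laplacian R G
  = row_fun (fun x => \sum_(y | adj x y) (f x - f y)).
Proof.
apply/rowP => j; rewrite mulmxBr mul_mx_diag !mxE.
rewrite (reindex _ (onW_bij _ (@enum_rank_bij G))) /= big_split /= sumrN; congr (_ - _).
  by rewrite degree_sum mulr_sumr; apply: eq_bigr => y _; rewrite mulr1.
rewrite [RHS]big_mkcond /=; apply: eq_bigr => x _.
rewrite !mxE !enum_rankK adj_sym.
by case: adj; rewrite ?mulr1 ?mulr0.
Qed.

Lemma laplacian_form (R : comPzRingType) (G : sgraph) (f : G -> R) :
  (row_fun f *m laplacian R G *m (row_fun f)^T) 0 0 *+ 2 = dirichlet f.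
Proof.
rewrite row_fun_laplacian row_fun_mul mulr2n.
under eq_bigr do rewrite mulr_suml big_mkcond /=.
(* One of the two copies gets [x] and [y] exchanged: [f x * (f x - f y) + f y * (f y - f x)] is the
   square wanted. *)
rewrite {2}exchange_big /= -big_split /dirichlet /=; apply: eq_bigr => x _.
rewrite [RHS]big_mkcond -big_split /=; apply: eq_bigr => y _.
by rewrite [adj y x]adj_sym; case: adj; rewrite ?addr0 //; ring.
Qed.

Lemma lap_largest_ge (R : rcfType) (G : sgraph) (f : G -> R) :
  dirichlet f <= lap_eigenvalue R G #|G| * (\sum_x f x ^+ 2) *+ 2.
Proof.
rewrite -laplacian_form ler_pMn2r //.
have := largest_eigen_ge (row_fun f) (laplacian_sym R G).
by rewrite row_fun_mul.
Qed.

Lemma lap_largest_le (R : rcfType) (G : sgraph) (c : R) :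
  (0 < #|G|)%N ->
  (forall f : G -> R, dirichlet f <= c * (\sum_x f x ^+ 2) *+ 2) ->
  lap_eigenvalue R G #|G| <= c.
Proof.
move=> G0 fc; apply: largest_eigen_le => // [|v]; first exact: laplacian_sym.
rewrite -(row_funP v) -(@ler_pMn2r _ 2) // laplacian_form row_fun_mul.
exact: fc.
Qed.

Lemma lap_second_ge (R : rcfType) (G : sgraph) (c : R) :
  (1 < #|G|)%N ->
  (forall f : G -> R, \sum_x f x = 0 ->
     c * (\sum_x f x ^+ 2) *+ 2 <= dirichlet f) ->
  c <= lap_eigenvalue R G 2.
Proof.
move=> G1 fc.
apply: (second_eigen_ge (u := row_fun (fun=> 1))) => // [|v].
  exact: laplacian_sym.
rewrite -(row_funP v) row_fun_mul => v0.
rewrite -(@ler_pMn2r _ 2) // laplacian_form row_fun_mul.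
by apply: fc; rewrite -[RHS]v0; apply: eq_bigr => x _; rewrite mulr1.
Qed.

Lemma dirichlet_ge0 (R : realDomainType) (G : sgraph) (f : G -> R) :
  0 <= dirichlet f.
Proof. by do 2![apply: sumr_ge0 => ? _]; rewrite sqr_ge0. Qed.

Lemma lap_second_le_centered (R : rcfType) (G : sgraph) (f : G -> R) :
  (1 < #|G|)%N -> \sum_x f x = 0 ->
  lap_eigenvalue R G 2 * (\sum_x f x ^+ 2) *+ 2 <= dirichlet f.
Proof.
move=> G1 f0; rewrite -laplacian_form ler_pMn2r //.
rewrite -[X in _ * X](_ : (row_fun f *m (row_fun f)^T) 0 0 = _); last first.
  exact: row_fun_mul.
have one_mul (g : G -> R) : \sum_x g x * 1 = \sum_x g x.
  by apply: eq_bigr => x _; rewrite mulr1.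
apply: (second_eigen_le (u := row_fun (fun=> 1))) => //.
- exact: laplacian_sym.
- have /card_gt0P[x _] := ltnW G1.
  apply/negP => /eqP/rowP/(_ (enum_rank x)); rewrite !mxE => /eqP.
  by rewrite oner_eq0.
- rewrite row_fun_laplacian; apply/rowP => i; rewrite !mxE big1 // => y _.
  by rewrite subrr.
- by rewrite row_fun_mul one_mul.
by rewrite -(@ler_pMn2r _ 2) // laplacian_form mul0rn dirichlet_ge0.
Qed.

(** Centring [f] at its mean keeps the Dirichlet sum. The factor [#|G|%:R] clears the denominator of
    the mean, and test functions need no centring. *)
Lemma lap_second_le (R : rcfType) (G : sgraph) (f : G -> R) :
  (1 < #|G|)%N ->
  lap_eigenvalue R G 2 * (#|G|%:R * (\sum_x f x ^+ 2) - (\sum_x f x) ^+ 2) *+ 2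
    <= #|G|%:R * dirichlet f.
Proof.
move=> G1; set N : R := #|G|%:R; set S := \sum_x f x.
have N0 : 0 < N by rewrite ltr0n ltnW.
pose g x := f x - S / N.
have g0 : \sum_x g x = 0.
  rewrite big_split /= sumr_const -/S -[_ *+ #|_|]mulr_natr -/N.
  by rewrite mulNr divfK ?subrr ?gt_eqF.
have := lap_second_le_centered G1 g0.
have -> : dirichlet g = dirichlet f.
  by apply: eq_bigr => x _; apply: eq_bigr => y _; rewrite /g; congr (_ ^+ 2); ring.
have -> : \sum_x g x ^+ 2 = \sum_x f x ^+ 2 - S ^+ 2 / N.
  have gE x : g x ^+ 2 = f x ^+ 2 + (f x * (- 2%:R * S / N) + (S / N) ^+ 2).
    by rewrite /g; field; rewrite gt_eqF.
  under eq_bigr do rewrite gE.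
  rewrite !big_split /= sumr_const -mulr_suml -/S -[_ *+ #|_|]mulr_natr -/N.
  by field; rewrite gt_eqF.
rewrite -(ler_pM2l N0); set l := lap_eigenvalue _ _ _.
suff -> : N * (l * (\sum_x f x ^+ 2 - S ^+ 2 / N) *+ 2)
    = l * (N * (\sum_x f x ^+ 2) - S ^+ 2) *+ 2 by [].
by field; rewrite gt_eqF.
Qed.

(** * Branches and centroid of a tree *)

Definition adj_avoid (G : sgraph) (c : G) : rel G :=
  [rel x y | [&& adj x y, x != c & y != c]].

(** For [v != c], the component of [v] once [c] is removed. *)
Definition branch (G : sgraph) (c v : G) : {set G} :=
  [set x | connect (adj_avoid c) v x].

Lemma adj_neq (G : sgraph) (x y : G) : adj x y -> x != y.
Proof. by move=> xy; apply/eqP => x_eq_y; rewrite x_eq_y adj_irr in xy. Qed.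

Lemma adj_avoid_sym (G : sgraph) (c : G) : symmetric (adj_avoid c).
Proof. by move=> x y; rewrite /adj_avoid /= adj_sym [(x != c) && _]andbC. Qed.

(** The empty path tests no edge, so it is allowed even from [c]. *)
Lemma path_avoid (G : sgraph) (c x : G) (p : seq G) :
  path (adj_avoid c) x p = path (@adj G) x p && ((p == [::]) || (c \notin x :: p)).
Proof.
elim: p x => //= y p IHp x; rewrite IHp /= !inE !negb_or [c == x]eq_sym [c == y]eq_sym.
rewrite /adj_avoid /=; case: (adj x y) => //=; case: (x == c); rewrite /= ?andbF //.
case: (y == c); rewrite /= ?andbF //; case: p {IHp} => [|z p] //=.
Qed.

Lemma branch_refl (G : sgraph) (c v : G) : v \in branch c v.
Proof. by rewrite inE connect0. Qed.

Lemma branch_notin (G : sgraph) (c v : G) : v != c -> c \notin branch c v.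
Proof.
move=> vc; rewrite inE; apply/negP => /connectP[p]; rewrite path_avoid.
case: p => [|x p] /andP[_ /= ]; first by move=> _ cv; rewrite cv eqxx in vc.
by move=> cp ce; case/negP: cp; rewrite in_cons {2}ce mem_last orbT.
Qed.

Lemma branch_step (G : sgraph) (c v x y : G) :
  v != c -> x \in branch c v -> adj x y -> y != c -> y \in branch c v.
Proof.
move=> vc xv xy yc; move: (xv); rewrite !inE => /connect_trans; apply.
apply: connect1; rewrite /adj_avoid /= xy yc andbT.
by apply: contraTneq xv => ->; exact: branch_notin.
Qed.

(** On a simple path from [c] to [x], the first step gives [v] and the rest never returns to [c]. *)
Lemma branch_cover (G : sgraph) (c x : G) :
  connected G -> x != c -> exists2 v, adj c v & x \in branch c v.
Proof.
move=> [_ /(_ c x)/connectP[p cp xE]] xc; case/shortenP: cp xE => q cq uq _ xE.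
case: q cq uq xE => [|v q] /= ; first by move=> _ _ xE; rewrite xE eqxx in xc.
move=> /andP[cv vq] /and3P[cnotin _ _] xE; exists v => //.
rewrite inE; apply/connectP; exists q => //.
by rewrite path_avoid vq cnotin orbT.
Qed.

(* Two neighbours of c in the same branch would close a cycle through c. *)
Lemma branch_neighbour (G : sgraph) (c v w : G) :
  tree G -> adj c v -> adj c w -> w \in branch c v -> w = v.
Proof.
move=> Gtree cv cw; rewrite inE => /connectP[p vp wE]; case/shortenP: vp wE => q vq uq _ wE.
apply/eqP/contraT => wv; have [_ /(_ [:: c, v & q])] := Gtree; case.
  by case: q vq uq wE => // _ _ /= wE; rewrite wE eqxx in wv.
move: vq; rewrite path_avoid => /andP[vq /orP[/eqP q0|cq]].
  by rewrite q0 in wE; rewrite wE eqxx in wv.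
by rewrite /ucycle /= cv rcons_path vq -wE adj_sym cw cq /= -cons_uniq.
Qed.

Lemma branch_disjoint (G : sgraph) (c v w x : G) :
  tree G -> adj c v -> adj c w -> x \in branch c v -> x \in branch c w -> w = v.
Proof.
move=> Gtree cv cw xv xw; apply: (branch_neighbour Gtree cv cw); move: xv xw; rewrite !inE => xv.
by rewrite (sym_connect_sym (@adj_avoid_sym G c) w x); exact: connect_trans xv.
Qed.

(** A path from [w] avoiding [v] cannot reach [c], or [w] and [c] would be two neighbours of [v] in
    one branch at [v]. Prefixed with [v], it is a path from [v] that avoids [c]. *)
Lemma branch_sub (G : sgraph) (c v w : G) :
  tree G -> adj c v -> adj v w -> w != c -> branch v w \subset branch c v :\ v.
Proof.
move=> Gtree cv vw wc; have vc : v != c by rewrite eq_sym adj_neq.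
have wv : w != v by rewrite eq_sym adj_neq.
have cnw : c \notin branch v w.
  apply/negP => cw; case/eqP: wc; apply/esym.
  by apply: branch_neighbour Gtree _ _ cw => //; rewrite adj_sym.
apply/subsetP => x xw; rewrite in_setD1; apply/andP; split.
  by apply: contraTneq xw => ->; exact: branch_notin.
move: (xw); rewrite inE => /connectP[p wp xE].
have sub_p y : y \in w :: p -> y \in branch v w.
  move=> yp; rewrite inE; case/splitPl: yp wp => p1 p2 <-; rewrite cat_path => /andP[wp1 _].
  by apply/connectP; exists p1.
have cp : c \notin w :: p by apply: contra cnw => /sub_p.
rewrite inE; apply/connectP; exists (w :: p) => //.
rewrite path_avoid /= vw; move: wp; rewrite path_avoid => /andP[-> _] /=.
by rewrite in_cons negb_or eq_sym vc cp.
Qed.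

(** Deleting the edge between [c] and [v] splits the tree into these two branches. *)
Lemma card_branch_sym (G : sgraph) (c v : G) :
  tree G -> adj c v -> (#|branch c v| + #|branch v c| = #|G|)%N.
Proof.
move=> Gtree cv; have vc : adj v c by rewrite adj_sym.
have [Gc _] := Gtree.
suff -> : branch v c = ~: branch c v by rewrite cardsC.
apply/setP => x; rewrite in_setC; have [->|xv] := eqVneq x v.
  by rewrite branch_refl (negPf (branch_notin _)) // adj_neq.
have [w vw xw] := branch_cover Gc xv.
have [wc|wc] := eqVneq w c.
  rewrite wc in xw; rewrite xw; apply/esym/negP => xcv.
  have [xc|xc] := eqVneq x c.
    by rewrite xc in xcv; have /negP := branch_notin (adj_neq vc); exact.
  move: xcv; rewrite inE => /connectP[p vp xE]; case/shortenP: vp xE => q vq uq _ xE.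
  case: q vq uq xE => [|u q] /=; first by move=> _ _ xE; rewrite xE eqxx in xv.
  move=> /andP[/and3P[vu _ uc] uq] /andP[vnq _] xE.
  (* A path from [v] to [x] that avoids [c] starts with another neighbour [u], which would put [x]
     in two branches at [v]. *)
  have xu : x \in branch v u.
    rewrite inE; apply/connectP; exists q => //.
    by move: uq; rewrite !path_avoid vnq orbT andbT => /andP[].
  by case/eqP: uc; apply: (branch_disjoint Gtree vc vu xw xu).
have xcv : x \in branch c v.
  by have /subsetP/(_ _ xw) := branch_sub Gtree cv vw wc; rewrite in_setD1 => /andP[].
rewrite xcv /=; apply/negP => xc.
by case/eqP: wc; apply: (branch_disjoint Gtree vc vw xc xw).
Qed.

(* Among the directed edges (c, v) for which the branch at c through v has at
   least half of the vertices, take one with the smallest branch: its head v is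
   a centroid. *)
Lemma centroid (G : sgraph) : tree G -> (1 < #|G|)%N ->
  exists c : G, forall v, adj c v -> (#|branch c v|.*2 <= #|G|)%N.
Proof.
move=> Gtree G1; have [Gc _] := Gtree.
pose P (e : G * G) := adj e.1 e.2 && (#|G| <= #|branch e.1 e.2|.*2)%N.
(* The branch sizes of the two orientations of an edge add up to [#|G|], so one orientation
   qualifies. *)
have [e0 Pe0] : exists e, P e.
  have /card_gt0P[c _] := ltnW G1.
  have [x xc] : exists x, x != c.
    have /card_gt1P[x [y [_ _ xy]]] := G1.
    have [xc|xc] := eqVneq x c; last by exists x.
    by exists y; rewrite eq_sym -xc.
  have [v cv _] := branch_cover Gc xc.
  have := card_branch_sym Gtree cv; have [cvn|cvn] := leqP #|G| (#|branch c v|.*2).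
    by exists (c, v); rewrite /P /= cv.
  move=> cvE; exists (v, c); rewrite /P /= adj_sym cv /=.
  move: cvn; rewrite -cvE -!addnn ltn_add2l leq_add2r; exact: ltnW.
case: (arg_minnP (fun e => #|branch e.1 e.2|) Pe0) => -[c v] /andP[/= cv cvn] cvmin.
(* Back towards [c] lies the complement of a branch with at least half of the vertices; any other
   step from [v] gives a strictly smaller branch, so minimality applies. *)
exists v => w vw; have [->|wc] := eqVneq w c.
  by rewrite -(card_branch_sym Gtree cv) -addnn leq_add2r -(leq_add2l #|branch c v|) addnn card_branch_sym.
have ltvw : (#|branch v w| < #|branch c v|)%N.
  by rewrite (cardsD1 v (branch c v)) branch_refl ltnS subset_leq_card ?branch_sub.
case: leqP => [//|/ltnW vwn]; have := cvmin (v, w); rewrite /P /= vw vwn.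
by move=> /(_ isT); rewrite leqNgt ltvw.
Qed.

(** * Test vectors *)

Lemma dirichlet_flat (R : comPzRingType) (G : sgraph) (c : G) (f : G -> R) :
  f c = 0 -> (forall x y, adj x y -> x != c -> y != c -> f x = f y) ->
  dirichlet f = (\sum_(y | adj c y) f y ^+ 2) *+ 2.
Proof.
move=> fc fE; rewrite /dirichlet (bigD1 c) //= mulr2n; congr (_ + _).
  by apply: eq_bigr => y _; rewrite fc sub0r sqrrN.
rewrite big_mkcond [RHS]big_mkcond; apply: eq_bigr => x _ /=.
have [->|xc] := eqVneq x c; first by rewrite adj_irr.
rewrite big_mkcond (bigD1 c) //= big1 ?addr0 => [|y yc].
  by rewrite adj_sym fc subr0.
by case: ifP => // xy; rewrite (fE _ _ xy) // subrr expr0n.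
Qed.

Lemma dirichlet_ge_at (R : realDomainType) (G : sgraph) (c : G) (f : G -> R) :
  (\sum_(y | adj c y) (f c - f y) ^+ 2) *+ 2 <= dirichlet f.
Proof.
rewrite /dirichlet [leRHS](bigD1 c) //= mulr2n lerD2l.
rewrite big_mkcond [leRHS]big_mkcond; apply: ler_sum => x _ /=.
have [->|xc] := eqVneq x c; first by rewrite adj_irr.
case: ifP => [cx|_]; last by apply: sumr_ge0 => y _; rewrite sqr_ge0.
rewrite (bigD1 c) 1?adj_sym //= -sqrrN opprB lerDl.
by apply: sumr_ge0 => y _; rewrite sqr_ge0.
Qed.

(** The test vector changes by [d + 1] along each edge at [c] and has squared norm [d ^+ 2 + d].
    Other edges can only add, so its Rayleigh quotient is at least [d + 1]. *)
Lemma lap_largest_ge_degree (R : rcfType) (G : sgraph) (c : G) :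
  (0 < degree c)%N -> (degree c).+1%:R <= lap_eigenvalue R G #|G|.
Proof.
move=> d0; set l := lap_eigenvalue _ _ _; set d : R := (degree c)%:R.
have d_gt0 : 0 < d by rewrite ltr0n.
pose f x : R := if x == c then d else - (adj c x)%:R.
have f2 : \sum_x f x ^+ 2 = d ^+ 2 + d.
  rewrite (bigD1 c) //= /f eqxx; congr (_ + _).
  rewrite /d degree_sum big_mkcond [RHS]big_mkcond; apply: eq_bigr => x _ /=.
  have [->|xc] := eqVneq x c; first by rewrite adj_irr.
  by case: adj; rewrite /= ?sqrrN ?expr1n ?expr0n.
have := le_trans (dirichlet_ge_at c f) (lap_largest_ge f).
rewrite -/l f2 ler_pMn2r // (eq_bigr (fun=> (d + 1) ^+ 2 * 1)) => [|y cy]; last first.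
  by rewrite /f eqxx eq_sym (negPf (adj_neq cy)) cy opprK mulr1.
rewrite -mulr_sumr -degree_sum -/d => le_l.
have dd : 0 < d ^+ 2 + d by rewrite addr_gt0 ?exprn_gt0.
rewrite -(ler_pM2r dd) -natr1 -/d; apply: le_trans le_l.
by rewrite le_eqVlt; apply/orP; left; apply/eqP; ring.
Qed.

(** Comparison with the complete graph, for which the sum over all ordered pairs is computed
    exactly. *)
Lemma lap_largest_le_card (R : rcfType) (G : sgraph) :
  (0 < #|G|)%N -> lap_eigenvalue R G #|G| <= #|G|%:R.
Proof.
move=> G0; apply: lap_largest_le => // f; set S := \sum_x f x.
have -> : #|G|%:R * (\sum_x f x ^+ 2) *+ 2
    = \sum_x \sum_y (f x - f y) ^+ 2 + S ^+ 2 *+ 2.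
  have E x : \sum_y (f x - f y) ^+ 2
      = #|G|%:R * f x ^+ 2 + (f x * (- 2%:R * S) + \sum_y f y ^+ 2).
    rewrite (eq_bigr (fun y => f x ^+ 2 + (f y * (- 2%:R * f x) + f y ^+ 2))).
      by rewrite !big_split /= sumr_const -mulr_suml -/S -[_ *+ #|_|]mulr_natr; ring.
    by move=> y _; ring.
  under [X in _ = X + _]eq_bigr do rewrite E.
  rewrite !big_split /= sumr_const -mulr_sumr -mulr_suml -/S.
  by rewrite -[_ *+ #|_|]mulr_natr; ring.
rewrite -[leLHS]addr0 lerD ?mulrn_wge0 ?sqr_ge0 //.
apply: ler_sum => x _; rewrite big_mkcond; apply: ler_sum => y _.
by case: ifP => // _; rewrite sqr_ge0.
Qed.

(** A star with centre [c], described without an isomorphism. *)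
Definition hub (G : sgraph) (c : G) : Prop :=
  forall x y : G, adj x y = (x != y) && ((x == c) || (y == c)).

(** For [f] of sum zero, the squares [(f c - f y) ^+ 2] over all [y] add up to the sum of the
    [f y ^+ 2] plus [#|G|] times [f c ^+ 2]. *)
Lemma lap_second_ge_hub (R : rcfType) (G : sgraph) (c : G) :
  (1 < #|G|)%N -> hub c -> 1 <= lap_eigenvalue R G 2.
Proof.
move=> G1 cP; apply: lap_second_ge => // f f0; rewrite mul1r.
apply: le_trans (dirichlet_ge_at c f); rewrite ler_pMn2r //.
have -> : \sum_(y | adj c y) (f c - f y) ^+ 2 = \sum_y (f c - f y) ^+ 2.
  rewrite big_mkcond; apply: eq_bigr => y _; rewrite cP eqxx andbT.
  by case: eqP => // ->; rewrite subrr expr0n.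
rewrite [leRHS](eq_bigr (fun y => f c ^+ 2 + (f y * (- 2%:R * f c) + f y ^+ 2))).
  rewrite !big_split /= sumr_const -mulr_suml f0 mul0r add0r lerDr.
  by rewrite mulrn_wge0 ?sqr_ge0.
by move=> y _; ring.
Qed.

Lemma star_hub (n : nat) (T : sgraph) :
  (0 < n)%N -> isomorphic T (star n) -> exists c : T, hub c.
Proof.
move=> n0 [f [g fK gK] fE]; exists (g (Ordinal n0)) => x y.
by rewrite -fE /= /star_adj (can_eq fK) -!(can2_eq fK gK).
Qed.

Lemma hub_star (T : sgraph) (c : T) : hub c -> isomorphic T (star #|T|).
Proof.
move=> cP; have T0 : (0 < #|T|)%N by apply/card_gt0P; exists c.
pose o : 'I_#|T| := Ordinal T0.
(* Enumerate the vertices, then swap the index of [c] with 0. *)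
pose f (x : T) : star #|T| := tperm (enum_rank c) o (enum_rank x).
have f_inj : injective f by move=> x y /perm_inj/enum_rank_inj.
have fc x : (f x == 0 :> nat) = (x == c).
  by rewrite -(inj_eq f_inj) /f tpermL.
exists f; first by apply: inj_card_bij; rewrite // card_ord.
by move=> x y; rewrite /= /star_adj (inj_eq f_inj) !fc cP.
Qed.

(** Serves with [phi] the identity and the square, for the sum and the norm of a test vector;
    [phi 0 = 0] removes the term at [c]. *)
Lemma sum_two_valued (R : pzRingType) (T : finType) (B : {set T}) (c : T)
    (a b : R) (phi : R -> R) :
  c \notin B -> phi 0 = 0 ->
  \sum_x phi (if x \in B then a else if x == c then 0 else b)
  = #|B|%:R * phi a + #|~: B :\ c|%:R * phi b.
Proof.
move=> cB phi0; rewrite (bigID (mem B)) /=; congr (_ + _).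
  rewrite (eq_bigr (fun=> phi a)) => [|x ->] //.
  by rewrite sumr_const mulr_natl.
rewrite (bigD1 c) //= (negPf cB) eqxx phi0 add0r.
rewrite (eq_bigr (fun=> phi b)) => [|x /andP[/negPf-> /negPf->]] //.
rewrite sumr_const mulr_natl; congr (_ *+ _); apply: eq_card => x.
by rewrite !inE andbC.
Qed.

(* [s] is the size of the largest branch at the centroid, which has k + 1
   branches, and [m] the number of vertices in the k others; the test vectors
   are [(a, b) = (m, s)] if [s <= m] and [(1, 1)] if [s = m + 1]. *)
Lemma rayleigh_bound (R : realFieldType) (s m k : nat) (l : R) :
  (0 < s)%N -> (0 < m)%N -> (k <= m)%N -> (m <= k * s)%N -> (s <= m.+1)%N ->
  (forall a b : R,
    l * ((s + m).+1%:R * (s%:R * a ^+ 2 + m%:R * b ^+ 2)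
         - (s%:R * a - m%:R * b) ^+ 2)
    <= (s + m).+1%:R * (a ^+ 2 + k%:R * b ^+ 2)) ->
  (s + m).+1%:R * l <= k.+2%:R /\
  ((s + m).+1%:R * l = k.+2%:R -> s = 1%N).
Proof.
move=> s0 m0 km mks sm1 Hl.
have natE : (s + m).+1%:R = s%:R + m%:R + 1 :> R by rewrite -natr1 natrD.
have kE : k.+2%:R = k%:R + 2 :> R by rewrite -addn2 natrD.
have sR : 1 <= s%:R :> R by rewrite ler1n.
have mR : 1 <= m%:R :> R by rewrite ler1n.
have kR : k%:R <= m%:R :> R by rewrite ler_nat.
have mksR : m%:R <= k%:R * s%:R :> R by rewrite -natrM ler_nat.
have k0 : 0 <= k%:R :> R by rewrite ler0n.
rewrite natE kE in Hl *.
have [sm|ms] := leqP s m; last first.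
  have sE : s%:R = m%:R + 1 :> R by rewrite natr1; congr (_%:R); lia.
  have := Hl 1 1; rewrite sE => H.
  set M : R := m%:R in H sE mR kR mksR *; set K : R := k%:R in H kR mksR k0 *.
  suff lt : (M + 1 + M + 1) * l < K + 2 by split; [exact: ltW | move=> e; rewrite e ltxx in lt].
  (* At [a = b = 1] the coefficient of [l] is [(2 * M + 2) * (2 * M + 1) - 1], that is this
     polynomial. The bound is strict because [K <= M], so equality does not occur here. *)
  have D0 : 0 < 4 * M ^+ 2 + 6 * M + 1 by nra.
  rewrite -(ltr_pM2r D0).
  have lD : l * (4 * M ^+ 2 + 6 * M + 1) <= (2 * M + 2) * (1 + K) by nra.
  have : (M + 1 + M + 1) * l * (4 * M ^+ 2 + 6 * M + 1) <= (2 * M + 2) * ((2 * M + 2) * (1 + K)) by nra.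
  move=> /le_lt_trans; apply; nra.
have smR : s%:R <= m%:R :> R by rewrite ler_nat.
(* For these values the subtracted square vanishes. *)
have := Hl m%:R s%:R => H.
have {}H : l * (s%:R * m%:R * (s%:R + m%:R)) <= m%:R ^+ 2 + k%:R * s%:R ^+ 2.
  have N0 : 0 < s%:R + m%:R + 1 :> R by lra.
  rewrite -(ler_pM2l N0); apply: le_trans H.
  by rewrite le_eqVlt; apply/orP; left; apply/eqP; ring.
set S : R := s%:R in H sR smR mksR *; set M : R := m%:R in H smR mR kR mksR *.
set K : R := k%:R in H kR mksR k0 *.
have D0 : 0 < S * M * (S + M) by rewrite !mulr_gt0 //; lra.
(* The slack is a sum of three nonnegative terms; equality kills the last one, which forces
   [S = 1]. *)
have gap : (S + M + 1) * (M ^+ 2 + K * S ^+ 2)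
    + ((S + M) * ((K * S - M) * (M - S)) + S ^+ 2 * (M - K) + M ^+ 2 * (S - 1))
    = (K + 2) * (S * M * (S + M)) by ring.
have g1 : 0 <= (S + M) * ((K * S - M) * (M - S)).
  by rewrite !mulr_ge0 ?subr_ge0 //; lra.
have g2 : 0 <= S ^+ 2 * (M - K) by rewrite mulr_ge0 ?sqr_ge0 ?subr_ge0.
have g3 : 0 <= M ^+ 2 * (S - 1) by rewrite mulr_ge0 ?sqr_ge0 ?subr_ge0.
have lD : (S + M + 1) * l * (S * M * (S + M)) <= (S + M + 1) * (M ^+ 2 + K * S ^+ 2).
  by rewrite -mulrA ler_wpM2l //; lra.
split; first by rewrite -(ler_pM2r D0); lra.
move=> e; rewrite e in lD.
have : M ^+ 2 * (S - 1) <= 0 by lra.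
rewrite pmulr_rle0 ?exprn_gt0 // ?(lt_le_trans ltr01) // subr_le0 lern1 => s1.
by apply/eqP; rewrite eqn_leq s1.
Qed.

(** The number [N], one more than the degree of the centroid, separates the two quantities to be
    compared; equality between them forces equality with [N]. *)
Lemma tree_lap_bounds (R : rcfType) (G : sgraph) :
  (3 <= #|G|)%N -> tree G ->
  exists c : G, exists N : R,
    [/\ 0 < N, N <= lap_eigenvalue R G #|G|,
        #|G|%:R * lap_eigenvalue R G 2 <= N &
        #|G|%:R * lap_eigenvalue R G 2 = N -> hub c].
Proof.
move=> G3 Gtree; have [Gc _] := Gtree.
have G1 : (1 < #|G|)%N by exact: ltnW.
have [c cmax] := centroid Gtree G1; exists c.
have [x0 x0c] : exists x, x != c.
  have /card_gt1P[x [y [_ _ xy]]] := G1.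
  by have [xc|xc] := eqVneq x c; [exists y; rewrite eq_sym -xc | exists x].
have [w0 cw0 _] := branch_cover Gc x0c.
case: (arg_maxnP (fun v => #|branch c v|) cw0) => v cv vmax.
have vc : v != c by rewrite eq_sym adj_neq.
(* The cardinals of [B], [C] and [A] are the [s], [m] and [k] of [rayleigh_bound]. *)
set B := branch c v in vmax; pose C := ~: B :\ c.
pose A := [set y | adj c y] :\ v.
have cB : c \notin B by exact: branch_notin.
have BC : (#|B| + #|C|).+1 = #|G|.
  by rewrite -(cardsC B) (cardsD1 c (~: B)) in_setC cB addnCA.
have dA : degree c = #|A|.+1 by rewrite /degree (cardsD1 v) inE cv.
have B0 : (0 < #|B|)%N by apply/card_gt0P; exists v; exact: branch_refl.
have B2 : (#|B|.*2 <= #|G|)%N by exact: cmax.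
(* [B] has at most half of at least three vertices, so some vertex other than [c] lies outside
   it. *)
have C0 : (0 < #|C|)%N by move: B2 G3; rewrite -BC; lia.
have nB y : adj c y -> y != v -> y \notin B.
  by move=> cy yv; apply: contra yv => yB; apply/eqP/(branch_neighbour Gtree cv cy).
have AC : (#|A| <= #|C|)%N.
  apply/subset_leq_card/subsetP => y; rewrite !inE => /andP[yv cy].
  by rewrite eq_sym adj_neq //=; have := nB y cy yv; rewrite inE.
(* The branches other than [B] cover [C], and none is larger than [B]. *)
have CA : (#|C| <= #|A| * #|B|)%N.
  have CU : C \subset \bigcup_(y in A) branch c y.
    apply/subsetP => x; rewrite in_setD1 in_setC => /andP[xc xB].
    have [y cy xy] := branch_cover Gc xc; apply/bigcupP; exists y => //.
    by rewrite !inE cy andbT; apply: contraNneq xB => yv; rewrite /B -yv.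
  apply: (leq_trans (subset_leq_card CU)).
  apply: (@leq_trans (\sum_(y in A) #|branch c y|)%N).
    elim/big_rec2: _ => [|y n F _ le_n]; first by rewrite cards0.
    by apply: leq_trans (leq_card_setU _ _) _; rewrite leq_add2l.
  rewrite -sum_nat_const leq_sum // => y; rewrite !inE => /andP[_ cy].
  exact: vmax.
exists #|A|.+2%:R.
have form a b : lap_eigenvalue R G 2 *
    ((#|B| + #|C|).+1%:R * (#|B|%:R * a ^+ 2 + #|C|%:R * b ^+ 2)
     - (#|B|%:R * a - #|C|%:R * b) ^+ 2)
    <= (#|B| + #|C|).+1%:R * (a ^+ 2 + #|A|%:R * b ^+ 2).
  (* With this sign, orthogonality to the constants reads [#|B|%:R * a = #|C|%:R * b]. *)
  pose f x : R := if x \in B then a else if x == c then 0 else - b.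
  have := lap_second_le f G1.
  have -> : \sum_x f x = #|B|%:R * a - #|C|%:R * b.
    by rewrite (sum_two_valued a (- b) (phi := id) cB) // mulrN.
  have -> : \sum_x f x ^+ 2 = #|B|%:R * a ^+ 2 + #|C|%:R * b ^+ 2.
    by rewrite (sum_two_valued a (- b) (phi := fun t => t ^+ 2) cB) ?expr0n // sqrrN.
  have -> : dirichlet f = (a ^+ 2 + #|A|%:R * b ^+ 2) *+ 2.
    rewrite (@dirichlet_flat _ _ c) => [||x y xy xc yc]; last first.
    - rewrite /f (negPf xc) (negPf yc).
      suff -> : (x \in B) = (y \in B) by [].
      apply/idP/idP => [xB|yB]; first exact: (branch_step vc xB).
      by apply: (branch_step vc yB); rewrite // adj_sym.
    - by rewrite /f (negPf cB) eqxx.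
    congr (_ *+ _); rewrite (bigD1 v) //= /f branch_refl; congr (_ + _).
    rewrite (eq_bigr (fun=> b ^+ 2)) => [|y /andP[cy yv]].
      rewrite sumr_const mulr_natl; congr (_ *+ _); apply: eq_card => y.
      by rewrite !inE andbC.
    by rewrite (negPf (nB _ cy yv)) eq_sym (negPf (adj_neq cy)) sqrrN.
  by rewrite BC mulrnAr ler_pMn2r.
have [] := rayleigh_bound B0 C0 AC CA _ form; first by move: B2; rewrite -BC; lia.
rewrite BC => le2 eq2; split=> //.
  by rewrite -dA; apply: lap_largest_ge_degree; rewrite dA.
move=> /eq2 B1.
(* All branches are now single vertices. *)
have all_adj x : x != c -> adj c x.
  move=> xc; have [y cy xy] := branch_cover Gc xc.
  have /cards1P[z zE] : #|branch c y| == 1%N.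
    rewrite eqn_leq (leq_trans (vmax _ cy)) ?B1 //=; apply/card_gt0P; exists y; exact: branch_refl.
  have := branch_refl c y; move: xy; rewrite zE !inE => /eqP-> /eqP<- //.
(* An edge missing [c] would put two neighbours of [c] in one branch. *)
have cP x y : x != c -> y != c -> adj x y = false.
  move=> xc yc; apply/negP => xy; have /eqP := adj_neq xy; apply.
  apply: (branch_neighbour Gtree (all_adj _ yc) (all_adj _ xc)).
  apply: branch_step yc (branch_refl _ _) _ xc; by rewrite adj_sym.
move=> x y; have [->|xc] := eqVneq x c; last have [->|yc] := eqVneq y c.
- have [<-|yc] := eqVneq c y; first by rewrite adj_irr.
  by rewrite all_adj // eq_sym.
- by rewrite adj_sym all_adj // xc.
by rewrite cP // andbF.
Qed.

Theorem theorem1p8 (R : rcfType) (n : nat) (T : sgraph)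
    (hn : (3 <= n)%N) (hcard : #|T| = n) (hT : tree T) :
  lap_eigenvalue R T 2 / lap_eigenvalue R T n <= n%:R^-1 /\
  (lap_eigenvalue R T 2 / lap_eigenvalue R T n = n%:R^-1 <->
   isomorphic T (star n)).
Proof.
subst n; have [c [N [N0 Nn N2 cP]]] := tree_lap_bounds R hn hT.
have G1 : (1 < #|T|)%N by exact: ltnW.
have G0 : (0 < #|T|)%N by exact: ltnW.
have nR : 0 < #|T|%:R :> R by rewrite ltr0n.
set l2 := lap_eigenvalue R T 2 in N2 cP *.
set ln := lap_eigenvalue R T _ in Nn *.
have ln0 : 0 < ln := lt_le_trans N0 Nn.
have leE : l2 / ln <= #|T|%:R^-1.
  by rewrite ler_pdivrMr // ler_pdivlMl // (le_trans N2).
split=> //; split=> [e|iso].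
  (* Equality gives [#|T|%:R * l2 = ln], and [N] lies between the two. *)
  apply: (@hub_star _ c); apply: cP; apply/eqP; rewrite eq_le N2 /=.
  apply: le_trans Nn _; rewrite le_eqVlt; apply/orP; left; apply/eqP.
  by rewrite -[l2](divfK (lt0r_neq0 ln0)) e mulrA divff ?mul1r ?gt_eqF.
have [h hP] := star_hub G0 iso.
apply/eqP; rewrite eq_le leE /= ler_pdivlMr // ler_pdivrMl //.
apply: le_trans (lap_largest_le_card R G0) _.
by rewrite ler_peMr ?(ltW nR) //; exact: lap_second_ge_hub hP.
Qed.
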